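(* Let $G$ be a graph with $n$ vertices and $Tr(G)=k$. Then $G$ is $Tr_k^{e}$-critical if and only if $G=H\cup\overline{K}_{n-n_H}$ (disjoint union), where $H$ is a $Tr_k^{(v,e)}$-critical graph having $n_H$ vertices.
   Context: All graphs are finite and simple; $\overline{K}_m$ is the edgeless graph on $m$ vertices. For disjoint $A,B\subseteq V$, $A$ dominates $B$ if every vertex of $B$ is adjacent to at least one vertex of $A$. A transitive $k$-partition of $G=(V,E)$ is a partition $\{V_1,\dots,V_k\}$ of $V$ into $k$ nonempty parts such that $V_i$ dominates $V_j$ for all $1\le i<j\le k$; the transitivity $Tr(G)$ is the maximum such $k$. $G$ is transitively edge critical if deleting any edge yields a graph of transitivity less than $Tr(G)$; with $Tr(G)=k$ it is called $Tr_k^{e}$-critical. $G$ is transitively vertex-edge critical if deleting any element of $V\cup E$ (deleting a vertex removes it with its incident edges) yields a graph of transitivity less than $Tr(G)$; with $Tr(G)=k$ it is called $Tr_k^{(v,e)}$-critical. *)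

(* Defs.v *)
From HB Require Import structures.
From mathcomp Require Import all_boot.

Set Implicit Arguments.
Unset Strict Implicit.
Unset Printing Implicit Defensive.

Record sgraph := SGraph {
  vertex :> finType;
  adj : rel vertex;
  adj_sym : symmetric adj;
  adj_irr : irreflexive adj }.

Definition edges (G : sgraph) : {set {set G}} :=
  [set e : {set G} | [exists x, exists y, adj x y && (e == [set x; y])]].

Section DelEdge.
Variables (G : sgraph) (e : {set G}).

Definition del_edge_adj : rel G := fun x y => adj x y && ([set x; y] != e).

Lemma del_edge_sym : symmetric del_edge_adj.
Proof. by move=> x y; rewrite /del_edge_adj adj_sym setUC. Qed.

Lemma del_edge_irr : irreflexive del_edge_adj.
Proof. by move=> x; rewrite /del_edge_adj adj_irr. Qed.

Definition del_edge : sgraph := SGraph del_edge_sym del_edge_irr.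
End DelEdge.

Section DelVertex.
Variables (G : sgraph) (v : G).

Definition del_vertex_adj : rel {x : G | x != v} :=
  fun x y => adj (val x) (val y).

Lemma del_vertex_sym : symmetric del_vertex_adj.
Proof. by move=> x y; rewrite /del_vertex_adj adj_sym. Qed.

Lemma del_vertex_irr : irreflexive del_vertex_adj.
Proof. by move=> x; rewrite /del_vertex_adj adj_irr. Qed.

Definition del_vertex : sgraph := SGraph del_vertex_sym del_vertex_irr.
End DelVertex.

Section Edgeless.
Variable m : nat.

Definition edgeless_adj : rel 'I_m := fun _ _ => false.

Lemma edgeless_sym : symmetric edgeless_adj. Proof. by []. Qed.

Lemma edgeless_irr : irreflexive edgeless_adj. Proof. by []. Qed.

Definition edgeless : sgraph := SGraph edgeless_sym edgeless_irr.
End Edgeless.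

Section DisjointUnion.
Variables G H : sgraph.

Definition dunion_adj : rel (G + H)%type := fun u v =>
  match u, v with
  | inl x, inl y => adj x y
  | inr x, inr y => adj x y
  | _, _ => false
  end.

Lemma dunion_sym : symmetric dunion_adj.
Proof. by case=> x [] y //=; rewrite adj_sym. Qed.

Lemma dunion_irr : irreflexive dunion_adj.
Proof. by case=> x /=; rewrite adj_irr. Qed.

Definition dunion : sgraph := SGraph dunion_sym dunion_irr.
End DisjointUnion.

Definition graph_iso (G H : sgraph) : Prop :=
  exists2 f : G -> H, bijective f & forall x y, adj (f x) (f y) = adj x y.

Section Transitivity.
Variable G : sgraph.

Definition dominates (A B : {set G}) : bool :=
  [forall y in B, exists x in A, adj x y].

(* Injectivity makes the k parts pairwise distinct; [partition] makes them
   nonempty, pairwise disjoint and covering. *)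
Definition transitive_partition k (V : {ffun 'I_k -> {set G}}) : bool :=
  [&& injectiveb V,
      partition [set V i | i : 'I_k] [set: G] &
      [forall i : 'I_k, forall j : 'I_k, (i < j) ==> dominates (V i) (V j)]].

Definition has_transitive_partition k : bool :=
  [exists V : {ffun 'I_k -> {set G}}, transitive_partition V].

(* The bound k <= #|G| loses nothing, and the maximum is attained: see the two
   lemmas below. The graph with no vertex has transitivity 0, through the
   partition with no part. *)
Definition Tr : nat := \max_(k < #|G|.+1 | has_transitive_partition k) k.

Lemma has_transitive_partition_leq k : has_transitive_partition k -> k <= Tr.
Proof.
move=> Pk; suff le_kG : k < #|G|.+1.
  exact: (@leq_bigmax_cond _ _ (fun k0 : 'I_#|G|.+1 => k0 : nat)
            (Ordinal le_kG) Pk).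
case/existsP: Pk => V /and3P[/injectiveP injV /and3P[/eqP covV tiV n0V] _].
rewrite ltnS -[k]card_ord -(card_imset _ injV) -[#|G|]cardsT -covV.
rewrite -(eqP tiV) -sum1_card; apply: leq_sum => A VA.
by rewrite card_gt0; apply: contraNneq n0V => <-.
Qed.

Lemma has_transitive_partition_Tr : has_transitive_partition Tr.
Proof.
have [k Pk] : exists k : 'I_#|G|.+1, has_transitive_partition k.
  have [G0|Gn0] := posnP #|G|.
    exists ord0; apply/existsP; exists [ffun=> set0].
    apply/and3P; split; first by apply/injectiveP; case.
      have -> : [set [ffun=> set0] i | i : 'I_0] = set0 :> {set {set G}}.
        by apply/setP => A; rewrite inE; apply/negP => /imsetP[[]].
      have -> : [set: G] = set0 by apply/eqP; rewrite -cards_eq0 cardsT G0.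
      by rewrite partition_set0.
    by apply/forallP; case.
  exists (Ordinal (Gn0 : 1 < #|G|.+1)); apply/existsP; exists [ffun=> setT].
  apply/and3P; split.
  - by apply/injectiveP => i j _; rewrite (ord1 i) (ord1 j).
  - have -> : [set [ffun=> setT] i | i : 'I_1] = [set [set: G]].
      apply/setP => A; rewrite inE; apply/imsetP/eqP => [[i _ ->]|->].
        by rewrite ffunE.
      by exists ord0; rewrite ?ffunE.
    apply/and3P; split; first by rewrite /cover big_set1.
      by rewrite /trivIset /cover !big_set1.
    by rewrite inE eq_sym -card_gt0 cardsT.
  - by apply/'forall_forallP => i j; rewrite (ord1 i) (ord1 j).
rewrite /Tr (bigop.bigmax_eq_arg k Pk).
by case: arg_maxnP.
Qed.
End Transitivity.

Definition edge_critical (G : sgraph) : Prop :=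
  forall e : {set G}, e \in edges G -> Tr (del_edge e) < Tr G.

Definition vertex_edge_critical (G : sgraph) : Prop :=
  (forall v : G, Tr (del_vertex v) < Tr G) /\ edge_critical G.

Definition Tr_edge_critical (k : nat) (G : sgraph) : Prop :=
  Tr G = k /\ edge_critical G.

Definition Tr_vertex_edge_critical (k : nat) (G : sgraph) : Prop :=
  Tr G = k /\ vertex_edge_critical G.

(* Main.v *)
Require Import Defs.
From mathcomp Require Import all_boot.

(** A transitive partition is the same thing as a vertex labelling in which
    every vertex labelled [j] has a neighbour of each label [i < j]; the
    transitivity exceeds [k] iff such a labelling attains [k]. Labellings extend
    by 0 along injective homomorphisms and restrict to any induced subgraph that
    contains all edges, so isolated vertices do not affect the transitivity as
    long as one vertex remains. Hence an edge critical graph may be cut down to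
    its non-isolated vertices (or to one vertex if it has no edge), and deleting
    a non-isolated vertex costs at least as much as deleting an edge at it. *)

Set Implicit Arguments.
Unset Strict Implicit.
Unset Printing Implicit Defensive.

Definition transitive_labelling (G : sgraph) (c : G -> nat) : Prop :=
  forall y i, i < c y -> exists2 z, adj z y & c z = i.

Lemma transitive_partition_labelling (G : sgraph) (k : nat)
    (V : {ffun 'I_k -> {set G}}) :
  transitive_partition V ->
  exists2 c : G -> 'I_k, transitive_labelling c & forall i, exists x, c x = i.
Proof.
case/and3P=> /injectiveP injV /and3P[/eqP covV tiV n0V] domV.
have ex_lab x : exists i, x \in V i.
  have: x \in cover [set V i | i : 'I_k] by rewrite covV inE.
  by case/bigcupP=> _ /imsetP[i _ ->] ?; exists i.
pose c x := xchoose (ex_lab x).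
have cP x : x \in V (c x) by exact: xchooseP (ex_lab x).
(* Disjointness makes the two blocks containing [x] equal, and injectivity of [V] then makes their
   indices equal. *)
have cE x i : x \in V i -> c x = i.
  move=> xVi; apply: injV; apply: contraTeq xVi => neqV.
  have /trivIsetP tiVP := tiV.
  have in_im j : V j \in [set V i | i : 'I_k] by exact: imset_f.
  have := tiVP _ _ (in_im (c x)) (in_im i) neqV.
  by move/disjoint_setI0/setP/(_ x); rewrite !inE cP /= => ->.
exists c => [y i lt_i|i]; last first.
  have [x /cE cx] : exists x, x \in V i.
    by apply/set0Pn; apply: contraNneq n0V => <-; exact: imset_f.
  by exists x.
have lt_ik : i < k by exact: ltn_trans lt_i (ltn_ord _).
move: domV => /forallP/(_ (Ordinal lt_ik))/forallP/(_ (c y))/implyP/(_ lt_i).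
move=> /forall_inP/(_ y (cP y))/exists_inP[z zV adj_zy].
by exists z; rewrite ?(cE _ _ zV).
Qed.

(** Resetting to 0 every label above [c x] leaves exactly the labels up to [c x]: [x] carries the
    largest, and its neighbours carry all the smaller ones. *)
Lemma labelling_transitive_partition (G : sgraph) (c : G -> nat) (x : G) :
  transitive_labelling c -> has_transitive_partition G (c x).+1.
Proof.
move=> cT; pose d y := if c y <= c x then c y else 0.
have dlt y : d y < (c x).+1 by rewrite /d; case: ifP.
have d_eq y : c y <= c x -> d y = c y by rewrite /d => ->.
have d_onto (i : 'I_(c x).+1) : exists y, d y = i.
  have := ltn_ord i; rewrite ltnS leq_eqVlt => /orP[/eqP ->|lt_i].
    by exists x; rewrite d_eq.
  have [z _ cz] := cT x _ lt_i; exists z.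
  by rewrite d_eq cz // ltnW.
pose V := [ffun i : 'I_(c x).+1 => [set y | d y == i]].
apply/existsP; exists V; apply/and3P; split.
- apply/injectiveP => i j /setP eqV; have [y dy] := d_onto i.
  by have := eqV y; rewrite !ffunE !inE dy eqxx => /esym/eqP/val_inj.
- apply/and3P; split.
  + apply/eqP/setP => y; rewrite inE; apply/bigcupP.
    exists (V (Ordinal (dlt y))); first exact: imset_f.
    by rewrite ffunE inE.
  + apply/trivIsetP => _ _ /imsetP[i _ ->] /imsetP[j _ ->] neqV.
    rewrite -setI_eq0; apply: contraNT neqV => /set0Pn[y].
    by rewrite !ffunE !inE => /andP[/eqP-> /eqP/val_inj->].
  + apply/imsetP => -[i _ /setP eqV]; have [y dy] := d_onto i.
    by have := eqV y; rewrite ffunE !inE dy eqxx.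
- apply/'forall_forallP => i j; apply/implyP => lt_ij.
  apply/forall_inP => y; rewrite ffunE inE => /eqP dy.
  (* A reset vertex has label 0 and so cannot lie in a part with positive index [j]. *)
  have dy_c : d y = c y by move: lt_ij; rewrite -dy /d; case: ifP.
  have [|z adj_zy cz] := cT y i; first by rewrite -dy_c dy.
  apply/exists_inP; exists z => //; rewrite ffunE inE d_eq cz //.
  by rewrite -ltnS ltn_ord.
Qed.

(** Labels start at 0, so attaining label [k] yields [k.+1] parts; this makes the inequality strict
    and covers the empty graph without a special case. *)
Lemma ltn_TrP (G : sgraph) (k : nat) :
  k < Tr G <->
  exists2 c : G -> nat, transitive_labelling c & exists x, c x = k.
Proof.
split=> [lt_k | [c cT [x <-]]]; last first.
  exact: has_transitive_partition_leq (labelling_transitive_partition x cT).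
case/existsP: (has_transitive_partition_Tr G) => V VT.
have [c cT c_onto] := transitive_partition_labelling VT.
have [x cx] := c_onto (Ordinal lt_k).
by exists (fun x => c x) => //; exists x; rewrite cx.
Qed.

Lemma leq_TrP (G H : sgraph) :
  (forall k, k < Tr G -> k < Tr H) -> Tr G <= Tr H.
Proof. by move=> ltGH; case E: (Tr G) => [//|k]; apply: ltGH; rewrite E. Qed.

Lemma Tr_gt0 (G : sgraph) (x : G) : 0 < Tr G.
Proof. by apply/ltn_TrP; exists (fun=> 0) => //; exists x. Qed.

(** Domination only asks for edges to be present, so extra edges of [H] do no harm, and label 0
    outside the image demands no neighbour. *)
Lemma leq_Tr_hom (G H : sgraph) (h : G -> H) :
  injective h -> (forall x y, adj x y -> adj (h x) (h y)) -> Tr G <= Tr H.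
Proof.
move=> h_inj h_adj; apply: leq_TrP => k /ltn_TrP[c cT [x cx]]; apply/ltn_TrP.
pose d y := if [pick x | h x == y] is Some x then c x else 0.
have dh u : d (h u) = c u.
  rewrite /d; case: pickP => [v /eqP/h_inj-> //|/(_ u)].
  by rewrite eqxx.
exists d; last by exists (h x); rewrite dh.
move=> y i; rewrite {1}/d; case: pickP => // u /eqP <- /cT[z adj_zu cz].
by exists (h z); rewrite ?dh //; exact: h_adj.
Qed.

(** An induced embedding that misses only isolated vertices; by symmetry of [adj], the last clause
    bounds both ends of each edge. *)
Definition core_embedding (H G : sgraph) (h : H -> G) : Prop :=
  [/\ injective h, forall x y, adj (h x) (h y) = adj x y
    & forall x y, adj x y -> x \in codom h].

(** Neighbours that a labelling demands are non-isolated, so they survive restriction to [H]. The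
    inhabitant of [H] excludes an empty [H] inside a nonempty edgeless [G], where the transitivities
    are 0 and 1. *)
Lemma leq_Tr_core (G H : sgraph) (h : H -> G) :
  core_embedding h -> H -> Tr G <= Tr H.
Proof.
case=> h_inj h_adj h_core x0; apply: leq_TrP => k /ltn_TrP[c cT [x cx]].
case: k cx => [_|k cx]; first exact: Tr_gt0 x0.
apply/ltn_TrP; exists (fun u => c (h u)) => [y i lt_i|].
  have [z adj_zy cz] := cT _ _ lt_i.
  have /codomP[u def_z] := h_core _ _ adj_zy.
  by exists u; rewrite -?h_adj -def_z.
(* A positive label forces a neighbour, so [x] itself lies in the image of [h]. *)
have [|z adj_zx _] := cT x 0; first by rewrite cx.
have /codomP[u def_x] : x \in codom h by apply: (h_core _ z); rewrite adj_sym.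
by exists u; rewrite -def_x.
Qed.

Lemma core_embedding_iso (G H : sgraph) (h : H -> G) :
  core_embedding h -> graph_iso G (dunion H (edgeless (#|G| - #|H|))).
Proof.
case=> h_inj h_adj h_core.
have cardC : #|[predC codom h]| = #|G| - #|H|.
  by rewrite -(cardC [in codom h]) (card_codom h_inj) addKn.
(* [r] enumerates the vertices missed by [h], all isolated; gluing it to [h] gives the inverse of
   the isomorphism. *)
pose r (i : 'I_(#|G| - #|H|)) : G := enum_val (cast_ord (esym cardC) i).
have rP i : r i \notin codom h.
  exact: (enum_valP (cast_ord (esym cardC) i)).
have r_iso i y : adj (r i) y = false.
  by apply: contraNF (rP i) => /h_core.
pose g (u : dunion H (edgeless (#|G| - #|H|))) : G :=
  match u with inl a => h a | inr i => r i end.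
have g_inj : injective g.
  move=> [a|i] [b|j] /= eq_g.
  - by rewrite (h_inj _ _ eq_g).
  - by have := rP j; rewrite -eq_g codom_f.
  - by have := rP i; rewrite eq_g codom_f.
  - by congr inr; apply: cast_ord_inj (enum_val_inj eq_g).
have g_adj u v : adj (g u) (g v) = adj u v.
  by case: u v => [a|i] [b|j] //=; rewrite ?r_iso // adj_sym r_iso.
have [|f gK fK] := inj_card_bij g_inj.
  by rewrite card_sum card_ord subnKC // -(card_codom h_inj) max_card.
exists f; first by exists g.
by move=> x y; rewrite -g_adj !fK.
Qed.

Lemma iso_core_embedding (G H : sgraph) (m : nat) :
  graph_iso G (dunion H (edgeless m)) -> exists h : H -> G, core_embedding h.
Proof.
case=> f [g fK gK] f_adj; exists (fun a => g (inl a)); split.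
- by move=> a b /(can_inj gK)[].
- by move=> a b; rewrite -f_adj !gK.
- move=> x y; rewrite -f_adj -{2}(fK x).
  case: (f x) (f y) => [a|i] [b|j] //= _.
  exact: (codom_f (fun b => g (inl b))).
Qed.

Section Induced.
Variables (G : sgraph) (S : {set G}).

Definition induced_adj : rel {x : G | x \in S} :=
  fun x y => adj (val x) (val y).

Lemma induced_sym : symmetric induced_adj.
Proof. by move=> x y; rewrite /induced_adj adj_sym. Qed.

Lemma induced_irr : irreflexive induced_adj.
Proof. by move=> x; rewrite /induced_adj adj_irr. Qed.

Definition induced : sgraph := SGraph induced_sym induced_irr.

Lemma induced_core_embedding :
  (forall x y, adj x y -> x \in S) ->
  core_embedding (val : induced -> G).
Proof.
move=> S_core; split=> // [|x y /S_core xS]; first exact: val_inj.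
by apply/codomP; exists (exist _ x xS).
Qed.
End Induced.

Lemma in_edges (G : sgraph) (x y : G) : adj x y -> [set x; y] \in edges G.
Proof.
by move=> adj_xy; rewrite inE; apply/existsP; exists x; apply/existsP; exists y;
  rewrite adj_xy eqxx.
Qed.

(** Injectivity of [h] on vertex sets ensures that exactly the matching edge disappears on each
    side. *)
Lemma core_embedding_del_edge (G H : sgraph) (h : H -> G) (a b : H) :
  core_embedding h ->
  core_embedding
    (h : del_edge [set a; b] -> del_edge [set h a; h b]).
Proof.
case=> h_inj h_adj h_core; split=> // [u v|x y /andP[/h_core]//].
rewrite /= /del_edge_adj h_adj; congr (_ && ~~ _).
have hU (s t : H) : [set h s; h t] = h @: [set s; t].
  by rewrite imsetU1 imset_set1.
by rewrite !hU (inj_eq (imset_inj h_inj)).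
Qed.

(** The edges of [G] are the images of those of [H], and the transitivities agree both before and
    after deleting a matching pair of edges. *)
Lemma core_embedding_edge_critical (G H : sgraph) (h : H -> G) (x0 : H) :
  core_embedding h -> edge_critical G <-> edge_critical H.
Proof.
move=> hP; have [h_inj h_adj h_core] := hP.
have eqTr : Tr G = Tr H.
  apply/eqP; rewrite eqn_leq (leq_Tr_core hP x0).
  by apply: (leq_Tr_hom h_inj) => x y; rewrite h_adj.
split=> crit e; rewrite inE => /existsP[x /existsP[y /andP[adj_xy /eqP->]]].
  have h_e : [set h x; h y] \in edges G by rewrite in_edges ?h_adj.
  rewrite -eqTr; apply: leq_ltn_trans (crit _ h_e).
  have [h_inj' h_adj' _] := core_embedding_del_edge x y hP.
  by apply: (leq_Tr_hom h_inj') => u v; rewrite h_adj'.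
have /codomP[a def_x] := h_core _ _ adj_xy.
have /codomP[b def_y] : y \in codom h by apply: (h_core y x); rewrite adj_sym.
rewrite eqTr def_x def_y.
apply: leq_ltn_trans (leq_Tr_core (core_embedding_del_edge a b hP) a) _.
by apply/crit/in_edges; rewrite -h_adj -def_x -def_y.
Qed.

Lemma leq_Tr_del_vertex (G : sgraph) (x y : G) :
  Tr (del_vertex x) <= Tr (del_edge [set x; y]).
Proof.
apply: (@leq_Tr_hom (del_vertex x) (del_edge [set x; y]) val val_inj).
move=> u v adj_uv.
rewrite /= /del_edge_adj [adj _ _]adj_uv /=.
(* If [[set x; y]] were the pair of [u] and [v], then [x] would be one of them, but both survive the
   deletion of [x]. *)
apply: contraTneq (set21 x y) => <-.
by rewrite !inE !(eq_sym x) (negPf (valP u)) (negPf (valP v)).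
Qed.

Lemma Tr_void (G : sgraph) : (G -> False) -> Tr G = 0.
Proof.
move=> G0; apply/eqP; rewrite -leqn0 leqNgt; apply/negP.
by case/ltn_TrP=> c _ [x _]; exact: G0 x.
Qed.

(** [S] is the set of non-isolated vertices, or a singleton when [G] has vertices but no edge, so
    that the transitivity does not drop to 0. The last clause is what vertex criticality needs. *)
Lemma exists_core (G : sgraph) :
  exists S : {set G},
    [/\ forall x y, adj x y -> x \in S, G -> exists x, x \in S
      & forall x, x \in S -> (exists y, adj x y) \/ S = [set x]].
Proof.
pose N := [set x : G | [exists y, adj x y]].
have inN x y : adj x y -> x \in N.
  by move=> adj_xy; rewrite inE; apply/existsP; exists y.
have [N0 | [x xN]] := set_0Vmem N; last first.
  exists N; split=> // [_|z]; first by exists x.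
  by rewrite inE => /existsP; left.
have [x _ | G0] := pickP (mem G).
  exists [set x]; split=> [u v /inN|_|z /set1P->]; last by right.
    by rewrite N0 in_set0.
  by exists x; rewrite set11.
by exists N; split=> // x; have := G0 x.
Qed.

Theorem theorem6 (G : sgraph) (n k : nat) (hn : #|G| = n) (hk : Tr G = k) :
  Tr_edge_critical k G <->
  exists H : sgraph,
    Tr_vertex_edge_critical k H /\
    graph_iso G (dunion H (edgeless (n - #|H|))).
Proof.
split=> [[_ critG] | [H [[_ [_ critH]] /iso_core_embedding[h hP]]]]; last first.
  split=> // e eG; move: (eG).
  rewrite inE => /existsP[x /existsP[y /andP[adj_xy _]]].
  (* The edge at hand supplies the inhabitant [a] of [H]; without edges there is nothing to
     prove. *)
  have [_ _ h_core] := hP; have /codomP[a _] := h_core _ _ adj_xy.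
  by have /(_ e eG) := (core_embedding_edge_critical a hP).2 critH.
have [S [S_core S_inh S_min]] := exists_core G.
have SP := induced_core_embedding S_core.
exists (induced S); rewrite -hn; split; last exact: core_embedding_iso SP.
have TrS : Tr (induced S) = k.
  apply/eqP; rewrite eqn_leq -hk (@leq_Tr_hom (induced S) G val val_inj) //=.
  apply: leq_TrP => j /ltn_TrP[c cT [x cx]].
  (* The vertex carrying label [j] shows that [G], hence [S], is nonempty. *)
  have [y yS] := S_inh x.
  apply: leq_trans (leq_Tr_core SP (exist _ y yS)).
  by apply/ltn_TrP; exists c => //; exists x.
split=> //; split=> [v|]; last first.
  move=> e eS; move: (eS); rewrite inE => /existsP[x _].
  exact: (core_embedding_edge_critical x SP).1.
(* Either [v] has a neighbour, and deleting [v] costs at least as much as deleting that edge, or [v]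
   is the only vertex of [S] and its deletion leaves the empty graph. *)
have [[y adj_vy] | defS] := S_min _ (valP v).
  have yS : y \in S by apply: (S_core y (val v)); rewrite adj_sym.
  pose w : induced S := exist _ y yS.
  apply: leq_ltn_trans (leq_Tr_del_vertex v w) _.
  by apply: ((core_embedding_edge_critical v SP).1 critG); exact: in_edges.
rewrite (@Tr_void (del_vertex v)) ?(Tr_gt0 v) // => -[u /eqP[]].
by apply/val_inj/set1P; rewrite -defS; exact: valP.
Qed.
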